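(* There exists a $2$-colouring of the edges of $\vec{K}_{\mathbb{N}}$, i.e. a map $c\colon E(\vec{K}_{\mathbb{N}})\to\{\text{red},\text{blue}\}$, such that every monochromatic directed path in $\vec{K}_{\mathbb{N}}$ has upper density $0$.
   Context: $\mathbb{N}$ denotes the positive integers. $\vec{K}_{\mathbb{N}}$ is the complete symmetric digraph on $\mathbb{N}$: its vertex set is $\mathbb{N}$ and its edges are all ordered pairs $(m,n)$ of distinct positive integers (so $(m,n)$ and $(n,m)$ are different edges and may receive different colours). The upper density of $A\subseteq\mathbb{N}$ is $\bar d(A)=\limsup_{n\to\infty}\frac{|A\cap\{1,\dots,n\}|}{n}$, and the upper density of a subgraph is that of its vertex set. A directed path is a finite or one-way infinite sequence of distinct vertices $v_1v_2\dots$ together with edges joining consecutive vertices that are all oriented in the same direction, i.e. either all edges are $(v_i,v_{i+1})$ (forward directed) or all edges are $(v_{i+1},v_i)$ (backward directed). It is monochromatic if all its edges have the same colour. *)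

(* Defs.v *)
From mathcomp Require Import all_boot all_order all_algebra finmap.
From mathcomp Require Import all_classical all_reals all_analysis.

Set Implicit Arguments.
Unset Strict Implicit.
Unset Printing Implicit Defensive.

Local Open Scope classical_set_scope.
Local Open Scope ring_scope.

Notation posnat := {n : nat | (0 < n)%N}.

(** The edge set of the complete symmetric digraph; the pair [(m, n)] is the
    edge oriented from [m] to [n]. *)
Notation edge := {e : posnat * posnat | e.1 != e.2}.

Inductive colour := red | blue.

Inductive vertex_seq :=
  | FinSeq of seq posnat
  | InfSeq of (nat -> posnat).

(** [item s i] is the [i]-th term of [s], counting from [0], or [None] if [s]
    is finite and has at most [i] terms. *)
Definition item (s : vertex_seq) (i : nat) : option posnat :=
  match s with
  | FinSeq l => onth l i
  | InfSeq v => Some (v i)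
  end.

Definition distinct_terms (s : vertex_seq) : Prop :=
  forall i j x, item s i = Some x -> item s j = Some x -> i = j.

Definition consecutive (s : vertex_seq) (x y : posnat) : Prop :=
  exists i, item s i = Some x /\ item s i.+1 = Some y.

Inductive direction := forward | backward.

(** Any two distinct vertices are joined by an edge in each direction, so a
    directed path is determined by its vertex sequence and its direction.
    The empty sequence is admitted; its vertex set is empty. *)
Record dipath := Dipath {
  path_seq : vertex_seq;
  path_distinct : distinct_terms path_seq;
  path_dir : direction }.

Definition path_vertices (p : dipath) : set posnat :=
  [set x | exists i, item (path_seq p) i = Some x].

Definition path_edges (p : dipath) : set edge :=
  [set e | match path_dir p with
           | forward => consecutive (path_seq p) (val e).1 (val e).2
           | backward => consecutive (path_seq p) (val e).2 (val e).1
           end].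

Definition monochromatic (c : edge -> colour) (p : dipath) : Prop :=
  exists k : colour, forall e : edge, path_edges p e -> c e = k.

(** The term of index [0] of the sequence is irrelevant to the limsup. *)
Definition upper_density (R : realType) (A : set posnat) : \bar R :=
  limn_esup (fun n : nat =>
    ((#|` fset_set (A `&` [set k : posnat | (val k <= n)%N])|%:R / n%:R : R)%:E)).

(* Main.v *)
(** Order the integers lexicographically by their binary digits, the least
    significant digit being compared first (the van der Corput order), and
    colour an edge red exactly when it goes up in this order.  The vertices of a
    monochromatic directed path are then monotone in the order, so for each [k]
    the numbers formed by reversing their last [k] digits are monotone and
    bounded by [2 ^ k], hence eventually constant.  All but finitely many
    vertices thus lie in a single residue class modulo [2 ^ k], which has
    density [2 ^- k]. *)

Require Import Defs.
From mathcomp Require Import all_boot all_order all_algebra finmap.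
From mathcomp Require Import all_classical all_reals all_analysis.
From mathcomp Require Import zify.

Set Implicit Arguments.
Unset Strict Implicit.
Unset Printing Implicit Defensive.

Import Order.TTheory GRing.Theory Num.Theory.
Import numFieldNormedType.Exports.
Local Open Scope classical_set_scope.

(** The lowest binary digit becomes the most significant, so raising [k] only refines the comparison
    of two numbers. *)
Fixpoint bitrev (k n : nat) : nat :=
  if k is j.+1 then 2 * bitrev j n + (n %/ 2 ^ j) %% 2 else 0.

Lemma bitrev_lt k n : bitrev k n < 2 ^ k.
Proof.
elim: k => [//|k IHk] /=; rewrite expnS.
by have := ltn_pmod (n %/ 2 ^ k) (isT : 0 < 2); lia.
Qed.

Lemma bitrev_modn k m n : bitrev k m = bitrev k n -> m = n %[mod 2 ^ k].
Proof.
elim: k => [|k IHk] /=; first by rewrite !modn1.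
move=> e.
have := ltn_pmod (m %/ 2 ^ k) (isT : 0 < 2).
have := ltn_pmod (n %/ 2 ^ k) (isT : 0 < 2).
move=> ? ?; have /IHk e1 : bitrev k m = bitrev k n by lia.
have : (m %/ 2 ^ k) %% 2 = (n %/ 2 ^ k) %% 2 by lia.
rewrite !modn_divl -expnS => e2.
have d : 2 ^ k %| 2 ^ k.+1 by rewrite expnS dvdn_mull.
(* A residue modulo [2 ^ k.+1] is rebuilt from digit [k], its quotient by [2 ^ k], and the residue
   modulo [2 ^ k]. *)
rewrite (divn_eq (m %% 2 ^ k.+1) (2 ^ k)) (divn_eq (n %% 2 ^ k.+1) (2 ^ k)).
by rewrite e2 !modn_dvdm // e1.
Qed.

Lemma nonincreasing_nat_stationary (u : nat -> nat) :
  (forall i, u i.+1 <= u i) -> exists N, forall i, N <= i -> u i = u N.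
Proof.
move=> u_dec; have ex : exists m, `[< exists i, u i = m >].
  by exists (u 0); apply/asboolP; exists 0.
case: (ex_minnP ex) => m /asboolP[N uN] m_min; exists N => i leNi.
apply/eqP; rewrite eqn_leq; apply/andP; split; last first.
  by rewrite uN; apply: m_min; apply/asboolP; exists i.
elim: i leNi => [|i IHi]; first by rewrite leqn0 => /eqP ->.
by rewrite leq_eqVlt => /predU1P[->//|/IHi]; apply: leq_trans.
Qed.

Lemma nondecreasing_nat_stationary (b : nat) (u : nat -> nat) :
  (forall i, u i <= b) -> (forall i, u i <= u i.+1) ->
  exists N, forall i, N <= i -> u i = u N.
Proof.
move=> u_le u_inc.
have [i|N uN] := @nonincreasing_nat_stationary (fun i => b - u i).
  by rewrite leq_sub2l.
exists N => i /uN; have := u_le i; have := u_le N; lia.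
Qed.

Lemma card_fset_set_le (T : choiceType) (A : set T) (s : seq T) :
  (forall x, A x -> x \in s) -> #|` fset_set A| <= size s.
Proof.
move=> As; apply: uniq_leq_size; first exact: fset_uniq.
move=> x; rewrite in_fset_set; first by rewrite inE => /As.
exact: (sub_finite_set As (finite_seq s)).
Qed.

Lemma card_residue_class_le (A : set posnat) (s : seq posnat) (q a n : nat) :
  0 < q -> (forall x, A x -> x \in s \/ val x = a %[mod q]) ->
  #|` fset_set (A `&` [set k : posnat | val k <= n])|
    <= size s + (n %/ q).+1.
Proof.
move=> q0 As.
(* Candidates up to [n] in the residue class; [insub] discards the value 0, which is not a
   vertex. *)
pose t : seq posnat :=
  pmap insub [seq a %% q + q * j | j <- iota 0 (n %/ q).+1].
apply: (@leq_trans (size (s ++ t))); last first.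
  rewrite size_cat leq_add2l size_pmap.
  by apply: leq_trans (count_size _ _) _; rewrite size_map size_iota.
apply: card_fset_set_le => x [/As[xs|xa] /= xn]; rewrite mem_cat ?xs //.
apply/orP; right; rewrite mem_pmap_sub; apply/mapP.
exists (val x %/ q); last by rewrite -xa addnC mulnC -divn_eq.
by rewrite mem_iota add0n ltnS leq_div2r.
Qed.

(** The hypothesis bounds the density by [1 / k] up to an error [C / n], for every [k > 0]; the
    quotients therefore converge to 0. *)
Lemma upper_density0 (R : realType) (A : set posnat) :
  (forall k : nat, exists C : nat, forall n : nat,
    k * #|` fset_set (A `&` [set x : posnat | val x <= n])| <= C + n) ->
  upper_density R A = 0%E.
Proof.
move=> cardA; pose d (n : nat) : R :=
  (#|` fset_set (A `&` [set x : posnat | (val x <= n)%N])|%:R / n%:R)%R.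
suff d0 : d n @[n --> \oo] --> (0 : R)%R.
  rewrite /upper_density; apply: (cvg_limn_einf_sup _).2.
  by apply: cvg_EFin; [exact: nearW|exact: d0].
apply/cvgrPdist_le => e e0.
pose k := Num.truncn (2 / e)%R.
have ke : (2 <= k.+1%:R * e)%R.
  by rewrite -ler_pdivrMr// ltW// truncnS_gt.
(* For [n > C] the bound [C + n] is at most [2 * n], whence the 2 in the choice of [k]. *)
have [C hC] := cardA k.+1; exists C.+1 => // n /= Cn.
have n0 : (0 < n%:R :> R)%R by rewrite ltr0n; lia.
rewrite sub0r normrN ger0_norm ?divr_ge0 ?ler0n// ler_pdivrMr//.
have k0 : (0 < k.+1%:R :> R)%R by rewrite ltr0n.
rewrite -(ler_pM2l k0) mulrA (@le_trans _ _ (2 * n%:R)%R)//; last first.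
  by rewrite ler_wpM2r// ltW.
by rewrite -!natrM ler_nat; have := hC n; lia.
Qed.

Lemma upper_density_eventually_residue0 (R : realType) (A : set posnat) :
  (forall k : nat, exists (s : seq posnat) (a : nat), forall x : posnat, A x ->
    x \in s \/ val x = a %[mod 2 ^ k]) ->
  upper_density R A = 0%E.
Proof.
move=> hA; apply: upper_density0 => k; have [s [a As]] := hA k.
(* The constant absorbs the exceptions in [s] and the rounding of [n / 2 ^ k]. *)
exists (2 ^ k * (size s).+1) => n.
have q0 : 0 < 2 ^ k by rewrite expn_gt0.
apply: (@leq_trans (2 ^ k * (size s + (n %/ 2 ^ k).+1))).
  apply: leq_mul; first exact: ltnW (ltn_expl k (isT : 1 < 2)).
  exact: (card_residue_class_le n q0 As).
by rewrite addnS -addSn mulnDr leq_add2l mulnC leq_trunc_div.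
Qed.

(* The comparison of [bitrev k m] and [bitrev k n] for large [k] is that of the
   full reversed binary expansions. *)
Definition bitrev_colouring (e : edge) : colour :=
  if `[< exists k, bitrev k (val (val e).1) < bitrev k (val (val e).2) >]
  then red else blue.

(** Further digits are appended at the low end, so a strict inequality persists at all higher
    levels; opposite ones at [k] and [j] would clash at level [j + k]. *)
Lemma bitrev_lt_le k j m n :
  bitrev k m < bitrev k n -> bitrev j m <= bitrev j n.
Proof.
have mono i l a b : bitrev i a < bitrev i b ->
    bitrev (l + i) a < bitrev (l + i) b.
  move=> lti; elim: l => [//|l IHl]; rewrite addSn /=.
  by have := ltn_pmod (a %/ 2 ^ (l + i)) (isT : 0 < 2); lia.
move=> /(mono k j m n) ltk; rewrite leqNgt; apply/negP => /(mono j k n m).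
by rewrite addnC; lia.
Qed.

(** The alternative depends on [c] alone, so all edges of a monochromatic path share it. *)
Lemma bitrev_colouring_monotone (c : colour) :
  (forall (e : edge) j, bitrev_colouring e = c ->
     bitrev j (val (val e).1) <= bitrev j (val (val e).2)) \/
  (forall (e : edge) j, bitrev_colouring e = c ->
     bitrev j (val (val e).2) <= bitrev j (val (val e).1)).
Proof.
rewrite /bitrev_colouring; case: c; [left|right] => e j; case: asboolP => //.
  by move=> [k /bitrev_lt_le].
by move=> nlt _; rewrite leqNgt; apply/negP => ltj; apply: nlt; exists j.
Qed.

Lemma infinite_monochromatic_stationary (v : nat -> posnat)
    (v_inj : distinct_terms (InfSeq v)) (dir : direction) :
  monochromatic bitrev_colouring (Dipath v_inj dir) ->
  forall k, exists N, forall i, N <= i ->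
    bitrev k (val (v i)) = bitrev k (val (v N)).
Proof.
move=> [c mono] k.
have v_neq i : v i != v i.+1.
  by apply/eqP => vi; have := v_inj i i.+1 (v i) erefl (congr1 Some (esym vi)); lia.
suff [dec|inc] : (forall i, bitrev k (val (v i.+1)) <= bitrev k (val (v i))) \/
    (forall i, bitrev k (val (v i)) <= bitrev k (val (v i.+1))).
- exact: (nonincreasing_nat_stationary dec).
- by apply: (nondecreasing_nat_stationary _ inc) => i; exact/ltnW/bitrev_lt.
(* On a backward path the edges run against the sequence, which swaps the two alternatives. *)
case: dir mono => mono.
- pose e i : edge := exist _ (v i, v i.+1) (v_neq i).
  have ec i : bitrev_colouring (e i) = c by apply: mono; exists i.
  by case: (bitrev_colouring_monotone c) => h; [right|left] => i;
    exact: h (e i) k (ec i).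
- have v_neq' i : v i.+1 != v i by rewrite eq_sym.
  pose e i : edge := exist _ (v i.+1, v i) (v_neq' i).
  have ec i : bitrev_colouring (e i) = c by apply: mono; exists i.
  by case: (bitrev_colouring_monotone c) => h; [left|right] => i;
    exact: h (e i) k (ec i).
Qed.

Theorem theorem1p2 (R : realType) :
  exists c : edge -> colour,
    forall p : dipath, monochromatic c p ->
      upper_density R (path_vertices p) = 0%E.
Proof.
exists bitrev_colouring => -[[l|v] p_dist dir] mono;
  apply: upper_density_eventually_residue0 => k.
  (* All vertices of a finite path count as exceptions; the residue 0 is arbitrary. *)
  by exists l, 0 => x lx; left; apply/onthP.
have [N vN] := infinite_monochromatic_stationary mono k.
exists [seq v i | i <- iota 0 N], (val (v N)) => x [i /= [<-]].
have [iN|Ni] := ltnP i N; [left|right].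
  by apply: map_f; rewrite mem_iota.
by apply: bitrev_modn; exact: vN.
Qed.
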